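(* For any real $s\ge 0$ the sequence $n\mapsto\|w_sT_n^{w_s}\|_{\mathbb{T}}$ is monotonically decreasing (in the non-strict sense) and $$\lim_{n\to\infty}\|w_sT_n^{w_s}\|_{\mathbb{T}}=1.$$
   Context: $\mathbb{T}$ is the unit circle and $\|g\|_{\mathbb{T}}=\sup_{z\in\mathbb{T}}|g(z)|$. For $s\ge0$, $w_s(z)=(z-1)^s$ (only $|w_s(z)|=|z-1|^s$ matters here). For a positive integer $n$, $T_n^{w_s}$ denotes the weighted Chebyshev polynomial of degree $n$ for the weight $|w_s|$ on $\mathbb{T}$: the unique monic polynomial of degree $n$ with complex coefficients such that $\|w_sT_n^{w_s}\|_{\mathbb{T}}=\min_{a_1,\dots,a_n\in\mathbb{C}}\max_{z\in\mathbb{T}}\left|(z-1)^s\prod_{k=1}^n(z-a_k)\right|$. *)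

(* Defs.v *)
From mathcomp Require Import all_boot all_order all_algebra.
From mathcomp Require Import all_classical all_reals all_analysis.
From mathcomp Require Import complex.

Set Implicit Arguments.
Unset Strict Implicit.
Unset Printing Implicit Defensive.

Import Order.TTheory GRing.Theory Num.Theory.
Import numFieldNormedType.Exports.

Local Open Scope classical_set_scope.
Local Open Scope ring_scope.
Local Open Scope complex_scope.

Definition unit_circle (R : realType) : set R[i] :=
  [set z | Normc.normc z = 1].

Definition norm_circle (R : realType) (g : R[i] -> R[i]) : R :=
  sup [set Normc.normc (g z) | z in @unit_circle R].

(* No branch of (z - 1)^s is chosen: only the modulus of the weight enters the
   norms below, so the weight is |z - 1|^s itself. At z = 1 it is 0 if s > 0
   and 1 if s = 0. *)
Definition weight (R : realType) (s : R) (z : R[i]) : R[i] :=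
  (Normc.normc (z - 1) `^ s)%:C.

(* The functions involved are continuous on the circle, so this supremum is
   also the maximum of |weight * p|. *)
Definition weighted_norm (R : realType) (s : R) (p : {poly R[i]}) : R :=
  norm_circle (fun z => weight s z * p.[z]).

Definition weighted_norms_of_degree (R : realType) (s : R) (n : nat) : set R :=
  [set weighted_norm s (\prod_(k < n) ('X - (a k)%:P)) | a in [set: 'I_n -> R[i]]].

Definition is_minimum (R : realType) (A : set R) (m : R) : Prop :=
  A m /\ lbound A m.

Definition is_chebyshev (R : realType) (s : R) (n : nat) (p : {poly R[i]}) :
    Prop :=
  [/\ p \is monic, size p = n.+1
    & is_minimum (weighted_norms_of_degree s n) (weighted_norm s p)].

(* The default value 0 is not a Chebyshev polynomial; it would be returned only
   if no minimizer existed. *)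
Definition chebyshev_poly (R : realType) (s : R) (n : nat) : {poly R[i]} :=
  xget 0 [set p | is_chebyshev s n p].

(* Main.v *)
(** Multiplying a degree [n] competitor by [z] does not change its modulus on the
    circle, so the minimal norms decrease.  Minimizers exist because projecting
    the roots onto the square [[-1, 1]^2] does not increase the norm, which is a
    supremum of continuous functions of the roots.

    Lower bound: if [q 0 = 1], then [|q| >= 1] somewhere on the circle.  For [M]
    the norm of [w_s p], apply this to the reversal of [(z - 1)^m p^j], with
    [m] the integer following [s j]: since [|z - 1| <= 2], this gives
    [1 <= 2 M^j] for every [j], whence [M >= 1].

    Upper bound: put [v = 1/z] and let [L] be the [n]-th partial sum of
    [- ln (1 - r v)].  The polynomials [z^(n k) (1 + s L / k)^k] are monic, and
    [|1 + w| <= exp (Re w + |w|^2 / 2)] bounds their modulus by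
    [exp (s Re L + s^2 n^2 / (2 k))], where [Re L] is close to [- ln |1 - r v|],
    while [|1 - v| <= 2 / (1 + r) |1 - r v|].  Let [k], then
    [n], tend to infinity, and then [r] to [1]. *)
Require Import Defs.
From mathcomp Require Import all_boot all_order all_algebra.
From mathcomp Require Import all_classical all_reals all_analysis.
From mathcomp Require Import complex.
From mathcomp Require Import ring lra zify.

Import Order.TTheory GRing.Theory Num.Theory.
Import numFieldNormedType.Exports.

Local Open Scope classical_set_scope.
Local Open Scope ring_scope.

Set Implicit Arguments.
Unset Strict Implicit.
Unset Printing Implicit Defensive.

Import Normc.

(** * Modulus of complex numbers and points of the unit circle *)

Lemma normc_ge0 (R : rcfType) (x : R[i]) : 0 <= normc x.
Proof. by case: x => a b; rewrite /normc sqrtr_ge0. Qed.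

Lemma normc_exp (R : rcfType) (x : R[i]) n : normc (x ^+ n) = normc x ^+ n.
Proof.
by elim: n => [|n IH]; rewrite ?expr0 ?normc1 // !exprS normcM IH.
Qed.

Lemma normc_prod (R : rcfType) (I : Type) (r : seq I) (F : I -> R[i]) :
  normc (\prod_(i <- r) F i) = \prod_(i <- r) normc (F i).
Proof. by rewrite (big_morph (@normc R) (@normcM R) (@normc1 R)). Qed.

Lemma normc_opp (R : rcfType) (x : R[i]) : normc (- x) = normc x.
Proof. exact: (@normcN R x). Qed.

Lemma ler_normcD (R : rcfType) (x y : R[i]) :
  normc (x + y) <= normc x + normc y.
Proof. exact: (@le_normcD R x y). Qed.

Lemma normc_real (R : rcfType) (x : R) : normc (x%:C)%C = `|x|.
Proof. by rewrite /= expr0n addr0 sqrtr_sqr. Qed.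

Lemma circle_neq0 (R : rcfType) (z : R[i]) : normc z = 1 -> z != 0.
Proof.
by move=> z1; apply/eqP => z0; move/eqP: z1; rewrite z0 normc0 eq_sym oner_eq0.
Qed.

Lemma sqr_normcE (R : rcfType) (x : R[i]) :
  normc x ^+ 2 = complex.Re x ^+ 2 + complex.Im x ^+ 2.
Proof. by case: x => a b; rewrite /= sqr_sqrtr// addr_ge0// sqr_ge0. Qed.

Lemma normc_mono (R : rcfType) (x y : R[i]) :
  `|complex.Re x| <= `|complex.Re y| -> `|complex.Im x| <= `|complex.Im y| ->
  normc x <= normc y.
Proof.
move: x y => [a b] [c d] /= ac bd.
rewrite ler_sqrt ?addr_ge0 ?sqr_ge0//.
by rewrite -[a ^+ 2]real_normK ?num_real// -[b ^+ 2]real_normK ?num_real//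
  -[c ^+ 2]real_normK ?num_real// -[d ^+ 2]real_normK ?num_real// lerD// lerXn2r.
Qed.

(** * Products of linear factors and their weighted norm *)

Definition cheb_product {R : realType} {n : nat} (a : 'I_n -> R[i]) : {poly R[i]} :=
  \prod_(k < n) ('X - (a k)%:P).

Definition wprod {R : realType} {n : nat} (s : R)
    (a : 'I_n -> R[i]) (z : R[i]) : R :=
  normc (z - 1) `^ s * \prod_(k < n) normc (z - a k).

Lemma normc_weight_cheb_product (R : realType) (s : R) n
    (a : 'I_n -> R[i]) (z : R[i]) :
  normc (weight s z * (cheb_product a).[z]) = wprod s a z.
Proof.
rewrite normcM normc_real ger0_norm ?powR_ge0// horner_prod normc_prod.
by congr (_ * _); apply: eq_bigr => k _; rewrite hornerXsubC.
Qed.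

Lemma wprod_ge0 (R : realType) (s : R) n (a : 'I_n -> R[i]) z : 0 <= wprod s a z.
Proof. by rewrite mulr_ge0 ?powR_ge0// prodr_ge0// => k _; exact: normc_ge0. Qed.

Lemma weighted_norm_le (R : realType) (s c : R) n (a : 'I_n -> R[i]) :
  (forall z, normc z = 1 -> wprod s a z <= c) ->
  weighted_norm s (cheb_product a) <= c.
Proof.
move=> H; apply: ge_sup.
  exists (normc (weight s 1 * (cheb_product a).[1])), 1 => //; exact: normc1.
by move=> _ [z /= z1 <-]; rewrite normc_weight_cheb_product H.
Qed.

Lemma wprod_le_weighted_norm (R : realType) (s : R) n (a : 'I_n -> R[i]) z :
  0 <= s -> normc z = 1 -> wprod s a z <= weighted_norm s (cheb_product a).
Proof.
move=> s0 z1; apply: ub_le_sup; last first.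
  by exists z => //; exact: normc_weight_cheb_product.
(* A supremum dominates its set only if the set is bounded above; this bound comes from the triangle
   inequality in each factor. *)
exists (2 `^ s * \prod_(k < n) (1 + normc (a k))).
move=> _ [w /= w1 <-]; rewrite normc_weight_cheb_product.
apply: ler_pM; rewrite ?powR_ge0//.
- by rewrite prodr_ge0// => k _; exact: normc_ge0.
- apply: ge0_ler_powR; rewrite ?nnegrE ?normc_ge0//.
  by apply: (le_trans (ler_normcD _ _)); rewrite normc_opp w1 normc1.
- apply: ler_prod => k _; rewrite normc_ge0/=.
  by apply: (le_trans (ler_normcD _ _)); rewrite normc_opp w1.
Qed.

Lemma weighted_norm_ge0 (R : realType) (s : R) n (a : 'I_n -> R[i]) :
  0 <= s -> 0 <= weighted_norm s (cheb_product a).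
Proof.
move=> s0; apply: le_trans (wprod_le_weighted_norm a s0 (normc1 R)).
exact: wprod_ge0.
Qed.

(** * Compactness and existence of minimizers *)

Definition clamp1 {R : realFieldType} (x : R) : R := Num.max (- 1) (Num.min 1 x).

Lemma clamp1_itv (R : realFieldType) (x : R) : -1 <= clamp1 x <= 1.
Proof. by rewrite /clamp1 le_max lexx ge_max ge_min lexx /= andbT; lra. Qed.

Lemma clamp1_dist (R : realFieldType) (x y : R) :
  -1 <= x <= 1 -> `|x - clamp1 y| <= `|x - y|.
Proof.
move=> /andP[x1 x2]; rewrite /clamp1; case: (leP 1 y) => h.
  by rewrite max_r; [rewrite !ler0_norm; lra | lra].
by case: (leP (-1) y) => h' //; rewrite !ger0_norm; lra.
Qed.

Lemma circle_itv (R : rcfType) (z : R[i]) : normc z = 1 ->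
  -1 <= complex.Re z <= 1 /\ -1 <= complex.Im z <= 1.
Proof.
move=> z1; have := sqr_normcE z; rewrite z1 expr1n => h.
by split; apply/andP; split; nra.
Qed.

(** Roots are encoded by real coordinates ([false] for the real part, [true] for the imaginary
    part), so that the parameter space is a product of copies of [R], as Tychonoff's theorem
    requires. *)
Definition box_point {R : realType} {n} (f : 'I_n * bool -> R) (k : 'I_n) : R[i] :=
  (f (k, false) +i* f (k, true))%C.

(** The circle lies in the square, so clamping the coordinates of a root brings it no farther, in
    either coordinate, from any point of the circle. *)
Lemma box_reduction (R : realType) (s : R) n (a : 'I_n -> R[i]) : 0 <= s ->
  exists2 f : 'I_n * bool -> R, (forall i, f i \in `[-1, 1]) &
    weighted_norm s (cheb_product (box_point f)) <= weighted_norm s (cheb_product a).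
Proof.
move=> s0.
exists (fun kb =>
  clamp1 (if kb.2 then complex.Im (a kb.1) else complex.Re (a kb.1))).
  by move=> [k b] /=; rewrite in_itv/= clamp1_itv.
apply: weighted_norm_le => z z1.
apply: le_trans (wprod_le_weighted_norm a s0 z1).
rewrite ler_wpM2l ?powR_ge0//; apply: ler_prod => k _; rewrite normc_ge0/=.
have [zr zi] := circle_itv z1; rewrite /box_point/=.
by apply: normc_mono; move: z zr zi {z1} (a k) => [x y] /= ? ? [u v] /=;
  apply: clamp1_dist.
Qed.


(** Continuity at each fixed [z] suffices: a bound on the supremum is a conjunction of closed
    conditions, one for each [z]. *)
Lemma wprod_box_continuous (R : realType) (s : R) n (z : R[i]) :
  continuous ((fun f => wprod s (box_point f) z) :
     prod_topology (fun _ : 'I_n * bool => R : topologicalType) -> R).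
Proof.
pose T := prod_topology (fun _ : 'I_n * bool => R : topologicalType).
have prj kb : continuous (fun f : T => f kb) by exact: proj_continuous.
have sq (x : R) kb : continuous (fun f : T => (x - f kb) ^+ 2).
  move=> f; have h : (fun f : T => x - f kb) @ f --> x - f kb.
    exact: (@cvgB R R T (nbhs f) _ (fun=> x) _ x (f kb) (cvg_cst x) (prj kb f)).
  have h2 : {for x - f kb, continuous (fun y : R => y ^+ 2)}.
    exact: exprn_continuous.
  exact: (@continuous_cvg T R R (nbhs f) _ _ (fun y => y ^+ 2) (x - f kb)).
have nrm k : continuous (fun f : T => normc (z - box_point f k)).
  rewrite /box_point; case: z => x y /= f.
  have h : (fun f : T => (x - f (k, false)) ^+ 2 + (y - f (k, true)) ^+ 2) @ f -->
      (x - f (k, false)) ^+ 2 + (y - f (k, true)) ^+ 2.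
    exact: (@cvgD R R T (nbhs f) _ _ _ _ _ (sq x (k, false) f) (sq y (k, true) f)).
  have h2 : {for (x - f (k, false)) ^+ 2 + (y - f (k, true)) ^+ 2,
      continuous (@Num.sqrt R)}.
    exact: sqrt_continuous.
  exact: (@continuous_cvg T R R (nbhs f) _ _ (@Num.sqrt R) _ h2 h).
have prd : continuous (fun f : T => \prod_(k < n) normc (z - box_point f k)).
  apply: (@continuous_big R 'I_n (@GRing.mul R) 1 xpredT) => //.
  exact: mul_continuous.
by move=> f; exact: (cvgM (cvg_cst _) (prd f)).
Qed.

Lemma exists_minimal_product (R : realType) (s : R) n : 0 <= s ->
  exists a : 'I_n -> R[i], forall b : 'I_n -> R[i],
    weighted_norm s (cheb_product a) <= weighted_norm s (cheb_product b).
Proof.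
move=> s0.
pose E := weighted_norms_of_degree s n.
have E0 : has_inf E.
  split.
    by exists (weighted_norm s (cheb_product (fun _ : 'I_n => 0))), (fun _ => 0).
  by exists 0 => _ [a _ <-]; exact: weighted_norm_ge0.
have Einf a : inf E <= weighted_norm s (@cheb_product R n a).
  by apply: ge_inf; [exact: E0.2 | exists a].
have /choice[f fP] : forall j : nat, exists f : 'I_n * bool -> R,
    (forall i, f i \in `[-1, 1]) /\
    weighted_norm s (cheb_product (box_point f)) <= inf E + j.+1%:R^-1.
  move=> j; have j0 : 0 < j.+1%:R^-1 :> R by rewrite invr_gt0.
  have [_ [a _ <-] aj] := inf_adherent j0 E0.
  have [f fb fa] := box_reduction a s0.
  exists f; split; first exact: fb.
  apply: (le_trans fa).
  exact: (ltW aj).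
pose T := prod_topology (fun _ : 'I_n * bool => R : topologicalType).
(* The minimizing sequence stays in the compact box, hence has a cluster point [p]. *)
have [] := @tychonoff _ (fun _ : 'I_n * bool => R : topologicalType)
  (fun _ => [set` `[(-1 : R), 1]]) (fun _ => @segment_compact R (-1) 1)
  ((f : nat -> T) @ \oo) _ _.
  by exists 0%N => // j _ i /=; exact: (fP j).1.
move=> p [_ pcl]; exists (box_point p) => b.
apply: le_trans (Einf b).
apply: weighted_norm_le => z z1.
apply/ler_addgt0Pr => e e0.
have [N _ Ne] := near_infty_natSinv_lt (PosNum e0).
(* This closed set contains a tail of the sequence, hence also its cluster point. *)
have clo : closed [set g : T | wprod s (box_point g) z <= inf E + e].
  apply: (@preimage_closed T R (fun g => wprod s (box_point g) z)
    [set x | x <= inf E + e]).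
    by move=> g _; exact: wprod_box_continuous.
  exact: closed_le.
apply: clo; move: pcl; rewrite clusterE; apply.
exists N => // j /= Nj.
apply: le_trans (wprod_le_weighted_norm _ s0 z1) _.
apply: le_trans (fP j).2 _.
by rewrite lerD2l ltW//; exact: Ne.
Qed.

(** * Chebyshev polynomials and the decrease of their norms *)

Lemma chebyshev_polyP (R : realType) (s : R) n : 0 <= s ->
  is_chebyshev s n (chebyshev_poly s n).
Proof.
move=> s0; have [b bP] := exists_minimal_product n s0.
apply: (xgetPex 0 (P := [set p | is_chebyshev s n p])).
exists (cheb_product b); split.
- exact: monic_prod_XsubC.
- by rewrite size_prod_XsubC -[in RHS](card_ord n) cardE enumT.
- by split; [exists b | move=> _ [c _ <-]; exact: bP].
Qed.

Lemma chebyshev_poly_min (R : realType) (s : R) n (a : 'I_n -> R[i]) : 0 <= s ->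
  weighted_norm s (chebyshev_poly s n) <= weighted_norm s (cheb_product a).
Proof. by move=> /(chebyshev_polyP n)[_ _ [_]]; apply; exists a. Qed.

Lemma chebyshev_poly_attained (R : realType) (s : R) n : 0 <= s ->
  exists a : 'I_n -> R[i],
    weighted_norm s (cheb_product a) = weighted_norm s (chebyshev_poly s n).
Proof. by move=> /(chebyshev_polyP n)[_ _ [[a _ aE] _]]; exists a. Qed.

Lemma chebyshev_norm_decr (R : realType) (s : R) n : 0 <= s ->
  weighted_norm s (chebyshev_poly s n.+1) <= weighted_norm s (chebyshev_poly s n).
Proof.
move=> s0; have [a <-] := chebyshev_poly_attained n s0.
(* The additional root is 0, whose factor has modulus one on the circle. *)
pose b (k : 'I_n.+1) := if unlift ord0 k is Some j then a j else 0.
apply: (le_trans (chebyshev_poly_min b s0)).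
apply: weighted_norm_le => z z1.
apply: le_trans (wprod_le_weighted_norm a s0 z1).
rewrite /wprod big_ord_recl /b unlift_none subr0 z1 mul1r.
by under eq_bigr do rewrite liftK.
Qed.

(** * Lower bound for the norms *)

(** The mean of [q(z)] and [q(-z)] is the even part of [q] at [z^2]. That part has the same constant
    term and, when [q] is not constant, a smaller size, so induction on the size applies. *)
Lemma exists_circle_value_ge1 (R : realType) (q : {poly R[i]}) : q`_0 = 1 ->
  exists2 z, normc z = 1 & 1 <= normc q.[z].
Proof.
elim: {q}(size q) {-2}q (leqnn (size q)) => [|n IH] q.
  by rewrite leqn0 size_poly_eq0 => /eqP -> /eqP; rewrite coef0 eq_sym oner_eq0.
case: (leqP (size q) 1) => [/size1_polyC -> _|q2 qn q0].
  by rewrite coefC/= => ->; exists 1; rewrite ?hornerC normc1.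
have [||w w1 ew] := IH (even_poly q).
- apply: leq_trans (size_even_poly q) _.
  by move: q2 qn; case: (size q) => [|[|k]] //= _; rewrite !ltnS => kn;
    apply: leq_trans kn; rewrite uphalf_half; lia.
- by rewrite coef_even_poly.
pose z := sqrtC w.
have zz : z ^+ 2 = w by exact: sqrtCK.
have z1 : normc z = 1.
  apply/eqP; rewrite -(@eqrXn2 _ 2) ?normc_ge0// -normc_exp zz w1 expr1n//.
have sumE : q.[z] + q.[- z] = 2 * (even_poly q).[w].
  have hq x : q.[x] = (even_poly q).[x ^+ 2] + (odd_poly q).[x ^+ 2] * x.
    by rewrite -{1}[q]poly_even_odd hornerD hornerM !horner_comp !hornerXn hornerX.
  by rewrite !hq sqrrN zz; ring.
case: (lerP 1 (normc q.[z])) => [h|h]; first by exists z.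
exists (- z); first by rewrite normc_opp.
have := ler_normcD q.[z] q.[- z].
rewrite sumE normcM.
have -> : normc (2 : R[i]) = 2.
  by rewrite -(rmorph_nat (real_complex R)) normc_real ger0_norm.
lra.
Qed.

Lemma one_le_weighted_norm (R : realType) (s : R) n (a : 'I_n -> R[i]) : 0 <= s ->
  1 <= weighted_norm s (cheb_product a).
Proof.
move=> s0; set M := weighted_norm _ _.
have M0 : 0 <= M by exact: weighted_norm_ge0.
have key j : 1 <= 2 * M ^+ j.
  have sj : 0 <= s * j%:R by rewrite mulr_ge0.
  (* Being a successor, [m] is positive even when [s * j] is 0, which excludes [t = 0] below. *)
  pose m := (Num.truncn (s * j%:R)).+1.
  have /andP[m1 m2] : s * j%:R <= m%:R <= s * j%:R + 1.
    by have := truncn_itv sj => /andP[? ?]; rewrite ltW//= /m -natr1 lerD2r.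
  have [] := @exists_circle_value_ge1 R
      ((1 - 'X) ^+ m * (\prod_(k < n) (1 - (a k) *: 'X)) ^+ j).
    rewrite -horner_coef0 !hornerE horner_prod big1 => [|k _]; last first.
      by rewrite !hornerE ?mulr0 ?subr0.
    by rewrite ?subr0 !expr1n ?mulr1.
  move=> w w1; rewrite !hornerE horner_prod normcM !normc_exp normc_prod.
  have w0 : w != 0 by exact: circle_neq0.
  (* Division by [w], of modulus one, turns the reversed factors back into the original ones at
     [1/w]. *)
  have wE b : normc (1 - b * w) = normc (w^-1 - b).
    by rewrite -[RHS]mul1r -w1 -normcM mulrBr divff// mulrC [w * b]mulrC.
  rewrite -[w in 1 - w]mul1r wE; under eq_bigr do rewrite !hornerE wE.
  set z := w^-1; have z1 : normc z = 1 by rewrite normcV w1 invr1.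
  set t := normc (z - 1); set P := \prod_(k < n) _ => tP.
  have P0 : 0 <= P by rewrite prodr_ge0// => k _; exact: normc_ge0.
  have t0 : 0 <= t by exact: normc_ge0.
  have tn0 : t != 0.
    by apply/eqP => tE; move: tP; rewrite tE exprS !mul0r ler10.
  have t2 : t <= 2.
    by apply: (le_trans (ler_normcD _ _)); rewrite normc_opp z1 normc1.
  apply: (le_trans tP).
  (* The surplus exponent [m - s j] lies between 0 and 1, and [t] is at most 2. *)
  have tm : t ^+ m <= 2 * (t `^ s) ^+ j.
    rewrite -[t ^+ m]powR_mulrn// -[_ ^+ j]powR_mulrn ?powR_ge0// -powRrM.
    rewrite -{1}[m%:R](subrK (s * j%:R)) powRD; last by rewrite tn0 implybT.
    rewrite ler_wpM2r ?powR_ge0//.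
    apply: (@le_trans _ _ (2 `^ (m%:R - s * j%:R))).
      by apply: ge0_ler_powR; rewrite ?nnegrE// subr_ge0.
    rewrite -[leRHS]powRr1//; apply: ler_powR; lra.
  apply: (@le_trans _ _ (2 * (wprod s a z) ^+ j)).
    by rewrite /wprod exprMn mulrA ler_wpM2r// exprn_ge0.
  rewrite ler_wpM2l// lerXn2r ?nnegrE ?wprod_ge0//.
  exact: wprod_le_weighted_norm.
(* If [M < 1], some power of [M] falls below 1/2, against [key]. *)
rewrite leNgt; apply/negP => M1.
have /cvgrPdist_lt/(_ (1 / 2)) : (fun j => M ^+ j) @ \oo --> (0 : R).
  by apply: cvg_expr; rewrite ger0_norm.
move=> /(_ ltac:(lra)) [N _ /(_ N (leqnn N))] /=.
rewrite sub0r normrN ger0_norm ?exprn_ge0//.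
have := key N; lra.
Qed.

(** * The truncated logarithm on the circle *)

(** With [v = exp(i theta)], this is the recurrence for [cos(n theta)]. *)
Lemma Re_expS_circle (R : rcfType) (v : R[i]) n : normc v = 1 ->
  complex.Re (v ^+ n.+2) =
    2 * complex.Re v * complex.Re (v ^+ n.+1) - complex.Re (v ^+ n).
Proof.
move=> v1; have := sqr_normcE v; rewrite v1 expr1n.
rewrite !exprS; move: (v ^+ n) => u; move: v {v1} u => [x y] [a b] /= h.
rewrite -[X in _ = _ - X]mul1r [X in _ = _ - X * _]h; ring.
Qed.

(** Real part of a finite geometric sum, cleared of its denominator [|1 - t v|^2]. *)
Lemma sum_Re_exp_circle (R : rcfType) (v : R[i]) (t : R) n : normc v = 1 ->
  (\sum_(j < n) t ^+ j * complex.Re (v ^+ j.+1)) *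
    (1 - 2 * t * complex.Re v + t ^+ 2) =
  complex.Re v - t - t ^+ n * (complex.Re (v ^+ n.+1) - t * complex.Re (v ^+ n)).
Proof.
move=> v1; elim: n => [|n IH]; first by rewrite big_ord0 !expr0 expr1 /=; ring.
rewrite big_ord_recr/= mulrDl IH Re_expS_circle// [t ^+ n.+1]exprS; ring.
Qed.

Definition log_partial {R : realType} (n : nat) (t : R) (v : R[i]) : R[i] :=
  \sum_(j < n) ((t ^+ j.+1 / j.+1%:R)%:C)%C * v ^+ j.+1.

(** For fixed [v], the real part of [log_partial] is a polynomial in [t]; this form makes it
    differentiable in [t]. *)
Definition re_log_poly {R : realType} (n : nat) (v : R[i]) : {poly R} :=
  \sum_(j < n) (complex.Re (v ^+ j.+1) / j.+1%:R) *: 'X^(j.+1).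

Lemma re_log_polyE (R : realType) n (t : R) (v : R[i]) :
  (re_log_poly n v).[t] = complex.Re (log_partial n t v).
Proof.
rewrite /re_log_poly /log_partial horner_sum.
rewrite (big_morph (@complex.Re R) (id1 := 0) (op1 := +%R)) => [|[? ?] [? ?] //|//].
apply: eq_bigr => j _; rewrite hornerZ hornerXn.
by case: (v ^+ j.+1) => a b /=; ring.
Qed.

Lemma deriv_re_log_poly (R : realType) n (t : R) (v : R[i]) :
  (re_log_poly n v)^`().[t] = \sum_(j < n) t ^+ j * complex.Re (v ^+ j.+1).
Proof.
rewrite /re_log_poly raddf_sum horner_sum; apply: eq_bigr => j _ /=.
rewrite derivZ derivXn hornerZ hornerMn hornerXn -[t ^+ _ *+ _]mulr_natr.
have : j.+1%:R != 0 :> R by rewrite pnatr_eq0.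
by move: (j.+1%:R) => m m0; field.
Qed.

Lemma Re_circle_le1 (R : rcfType) (v : R[i]) n : normc v = 1 ->
  `|complex.Re (v ^+ n)| <= 1.
Proof.
move=> v1; have : normc (v ^+ n) = 1 by rewrite normc_exp v1 expr1n.
by move=> /circle_itv[+ _]; rewrite ler_norml.
Qed.

(** The first term is [ln |1 - r v|], so the left side is the error of the truncated logarithm. As a
    function of the radius it vanishes at 0, and the mean value theorem reduces the claim to a bound
    on its derivative. *)
Lemma ln_add_re_log_le (R : realType) n (r : R) (v : R[i]) : normc v = 1 ->
  0 < r < 1 ->
  ln (1 - 2 * r * complex.Re v + r ^+ 2) / 2 + complex.Re (log_partial n r v)
    <= 2 * r ^+ n / (1 - r) ^+ 2.
Proof.
move=> v1 /andP[r0 r1]; set x := complex.Re v.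
have [/andP[x1 x2] _] := circle_itv v1; rewrite -/x in x1 x2.
pose Q : {poly R} := 1%:P - (2 * x) *: 'X + 'X^2.
have QE t : Q.[t] = 1 - 2 * t * x + t ^+ 2 by rewrite /Q !hornerE; ring.
have QE' t : Q^`().[t] = 2 * (t - x).
  by rewrite /Q derivD derivB derivC derivZ derivX derivXn !hornerE /=; ring.
(* [Q(t) = |1 - t v|^2] is at least [(1 - t)^2]. *)
have Q_ge t : 0 <= t <= r -> (1 - r) ^+ 2 <= Q.[t].
  by move=> /andP[t0 tr]; rewrite QE; nra.
have Q_gt0 t : 0 <= t <= r -> 0 < Q.[t].
  by move=> /Q_ge; apply: lt_le_trans; rewrite exprn_gt0// subr_gt0.
pose phi := 2^-1 *: (@ln R \o horner Q) + horner (re_log_poly n v).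
pose dphi t := 2^-1 *: (Q.[t]^-1 * Q^`().[t]) + (re_log_poly n v)^`().[t].
have dE t : 0 <= t <= r -> is_derive t (1 : R) phi (dphi t).
  move=> /Q_gt0 Qt; apply: is_deriveD.
  apply: is_deriveZ; apply: is_derive1_comp; exact: is_derive1_ln.
have [||c /andP[c0 cr]] := @MVT_segment R phi dphi 0 r (ltW r0).
- by move=> t /andP[t0 tr]; apply: dE; rewrite !ltW.
- apply: derivable_within_continuous => t; rewrite in_itv/= => /dE.
  by move=> [].
rewrite !bnd_simp in c0 cr.
have -> : phi 0 = 0.
  rewrite /phi !fctE /= QE re_log_polyE /log_partial big1 => [|j _].
    by rewrite expr0n/= !(mulr0, mul0r, subr0, addr0) ln1 scaler0.
  by rewrite exprS !mul0r.
rewrite !subr0 => E; rewrite [leLHS](_ : _ = phi r); last first.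
  by rewrite -re_log_polyE -QE mulrC.
have Qc : 0 < Q.[c] by apply: Q_gt0; rewrite c0 cr.
(* The derivative of the logarithm cancels the main part of the geometric sum; only its tail
   remains. *)
have dphiE : dphi c =
    - (c ^+ n * (complex.Re (v ^+ n.+1) - c * complex.Re (v ^+ n))) / Q.[c].
  rewrite /dphi deriv_re_log_poly.
  have := sum_Re_exp_circle c n v1; rewrite -QE => SE.
  apply: (mulIf (lt0r_neq0 Qc)); rewrite mulrDl SE QE' /GRing.scale/=; field.
  exact: lt0r_neq0.
have num_le : - (complex.Re (v ^+ n.+1) - c * complex.Re (v ^+ n)) <= 2.
  have := Re_circle_le1 n v1; have := Re_circle_le1 n.+1 v1.
  rewrite !ler_norml => /andP[? ?] /andP[? ?].
  nra.
rewrite E dphiE.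
have cn0 : 0 <= c ^+ n by rewrite exprn_ge0.
have cnr : c ^+ n <= r ^+ n by apply: lerXn2r; rewrite ?nnegrE // (le_trans c0 cr).
have Qr : (1 - r) ^+ 2 <= Q.[c] by apply: Q_ge; rewrite c0 cr.
have r10 : 0 < (1 - r) ^+ 2 by rewrite exprn_gt0// subr_gt0.
apply: (@le_trans _ _ (2 * r ^+ n / (1 - r) ^+ 2 * r)); last first.
  apply: ler_piMr; last exact: ltW.
  by rewrite divr_ge0 ?sqr_ge0// mulr_ge0// exprn_ge0// ltW.
apply: ler_wpM2r; first exact: ltW.
apply: (@le_trans _ _ (2 * r ^+ n / Q.[c])).
  apply: ler_wpM2r; first by rewrite invr_ge0 ltW.
  rewrite -mulrN; apply: (le_trans (ler_wpM2l cn0 num_le)).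
  by rewrite mulrC ler_wpM2l.
apply: ler_wpM2l; last by rewrite lef_pV2.
by rewrite mulr_ge0// exprn_ge0// ltW.
Qed.

(** * Exponential bounds for the weight and the approximating powers *)

(** After squaring, this is [1 + x <= exp x] at [x = 2 Re w + |w|^2]. *)
Lemma normc_1D_le_expR (R : realType) (w : R[i]) :
  normc (1 + w) <= expR (complex.Re w + normc w ^+ 2 / 2).
Proof.
rewrite -(@ler_pXn2r _ 2) ?nnegrE ?normc_ge0 ?expR_ge0//.
rewrite -expRM_natl; apply: le_trans (expR_ge1Dx _).
by rewrite mulrDr [_%:R * (_ / _)]mulrC divfK// !sqr_normcE; case: w => a b /=; lra.
Qed.

(** A crude bound is enough, because [k] is chosen after [n]. *)
Lemma log_partial_le (R : realType) n (r : R) (v : R[i]) : normc v = 1 ->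
  0 < r < 1 -> normc (log_partial n r v) <= n%:R.
Proof.
move=> v1 /andP[r0 r1]; rewrite /log_partial.
elim: n => [|n IH]; first by rewrite big_ord0 normc0.
rewrite big_ord_recr/= -[leRHS]natr1; apply: (le_trans (ler_normcD _ _)).
rewrite lerD// normcM normc_exp v1 expr1n mulr1 normc_real ger0_norm; last first.
  by rewrite divr_ge0// exprn_ge0// ltW.
rewrite ler_pdivrMr// mul1r; apply: (@le_trans _ _ 1); last by rewrite ler1n.
by rewrite exprn_ile1// ltW.
Qed.

(** Combines [|v - 1| <= 2 / (1 + r) |1 - r v|] with [2 / (1 + r) <= 2 - r <= exp (1 - r)]. *)
Lemma dist_1_le_expR (R : realType) (r : R) (v : R[i]) : normc v = 1 ->
  0 < r < 1 ->
  normc (v - 1) <= expR (1 - r + ln (1 - 2 * r * complex.Re v + r ^+ 2) / 2).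
Proof.
move=> v1 /andP[r0 r1]; set x := complex.Re v; set D := (X in ln X).
have [/andP[x1 x2] _] := circle_itv v1; rewrite -/x in x1 x2.
have D0 : 0 < D by rewrite /D; nra.
rewrite -(@ler_pXn2r _ 2) ?nnegrE ?normc_ge0 ?expR_ge0//.
rewrite -expRM_natl mulrDr [in _%:R * (_ / _)]mulrC divfK// expRD lnK ?posrE//.
have h2 : (2 - r) ^+ 2 <= expR (2 * (1 - r)).
  rewrite [expR _]expRM_natl lerXn2r ?nnegrE ?expR_ge0//; first lra.
  by apply: le_trans (expR_ge1Dx (1 - r)); lra.
apply: (@le_trans _ _ ((2 - r) ^+ 2 * D)); last by rewrite ler_wpM2r// ltW.
have -> : normc (v - 1) ^+ 2 = 2 - 2 * x.
  rewrite sqr_normcE; have := sqr_normcE v; rewrite v1 expr1n.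
  by rewrite /x; case: v {v1 x1 x2 D D0 x} => a b /= h; lra.
have h3 : 2 ^+ 2 <= ((2 - r) * (1 + r)) ^+ 2 by rewrite lerXn2r ?nnegrE//; nra.
have h4 : (2 - 2 * x) * (1 + r) ^+ 2 <= 2 ^+ 2 * D.
  rewrite -subr_ge0 [leRHS](_ : _ = 2 * (1 - r) ^+ 2 * (1 + x)).
    by rewrite !mulr_ge0// ?sqr_ge0//; lra.
  by rewrite /D; ring.
rewrite -(@ler_pM2r _ ((1 + r) ^+ 2)); last by rewrite exprn_gt0//; lra.
apply: (le_trans h4); rewrite [leRHS]mulrAC -exprMn.
by rewrite ler_wpM2r// ltW.
Qed.

(** The terms in [ln |1 - r v|] cancel. The three errors left come from moving to radius [r],
    truncating the logarithm, and using a [k]-th power for the exponential. *)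
Lemma weight_approx_le (R : realType) (s r : R) (n k : nat) (v : R[i]) :
  0 <= s -> 0 < r < 1 -> (0 < k)%N -> normc v = 1 ->
  normc (v - 1) `^ s * normc (1 + ((s / k%:R)%:C)%C * log_partial n r v) ^+ k <=
  expR (s * (1 - r) + s * (2 * r ^+ n / (1 - r) ^+ 2) +
        s ^+ 2 * n%:R ^+ 2 / (2 * k%:R)).
Proof.
move=> s0 r01 k0 v1.
set L := log_partial n r v.
pose lnD := ln (1 - 2 * r * complex.Re v + r ^+ 2) / 2.
have k0' : 0 < k%:R :> R by rewrite ltr0n.
have h1 : normc (v - 1) `^ s <= expR (s * (1 - r + lnD)).
  rewrite mulrC expRM; apply: ge0_ler_powR; rewrite ?nnegrE ?normc_ge0 ?expR_ge0//.
  exact: dist_1_le_expR.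
have h2 : normc (1 + ((s / k%:R)%:C)%C * L) ^+ k <=
    expR (s * complex.Re L + s ^+ 2 * n%:R ^+ 2 / (2 * k%:R)).
  have -> : s * complex.Re L + s ^+ 2 * n%:R ^+ 2 / (2 * k%:R) =
      k%:R * (s / k%:R * complex.Re L + (s / k%:R * n%:R) ^+ 2 / 2).
    by field; exact: lt0r_neq0.
  rewrite expRM_natl lerXn2r ?nnegrE ?normc_ge0 ?expR_ge0//.
  apply: (le_trans (normc_1D_le_expR _)); rewrite ler_expR lerD//.
    by case: L => a b /=; rewrite mul0r subr0.
  rewrite ler_wpM2r// lerXn2r ?nnegrE ?normc_ge0// ?mulr_ge0 ?invr_ge0//.
  rewrite normcM normc_real ger0_norm ?divr_ge0//.
  by rewrite ler_wpM2l ?divr_ge0// log_partial_le.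
apply: (le_trans (ler_pM (powR_ge0 _ _) _ h1 h2)).
  by rewrite exprn_ge0// normc_ge0.
rewrite -expRD ler_expR addrA lerD2r -mulrDr -[leRHS]mulrDr ler_wpM2l//.
by rewrite -addrA lerD2l ln_add_re_log_le.
Qed.

(** * Choice of parameters and nearly optimal monic polynomials *)

(** First [r], then [n], then [k] is chosen, each making one term at most [d / 3]. *)
Lemma exists_small_parameters (R : realType) (s d : R) : 0 <= s -> 0 < d ->
  exists (r : R) (n k : nat), [/\ 0 < r < 1, (0 < k)%N &
    s * (1 - r) + s * (2 * r ^+ n / (1 - r) ^+ 2) + s ^+ 2 * n%:R ^+ 2 / (2 * k%:R)
      <= d].
Proof.
move=> s0 d0.
pose h := d / 3; have h0 : 0 < h by rewrite divr_gt0.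
pose u := h / (s + 1 + h).
have den0 : 0 < s + 1 + h by lra.
have u0 : 0 < u by rewrite divr_gt0.
have u1 : u < 1 by rewrite ltr_pdivrMr//; lra.
have su : s * u <= h.
  by rewrite mulrA ler_pdivrMr// mulrC ler_wpM2l// ?ltW//; lra.
pose r := 1 - u.
have r1 : 1 - r = u by rewrite /r; ring.
(* Once [r ^+ n] is below this threshold, the second term is at most [h]; [s + 1] keeps the divisor
   positive when [s = 0]. *)
have c0 : 0 < h * u ^+ 2 / (2 * (s + 1)).
  by apply: divr_gt0; [rewrite mulr_gt0 ?exprn_gt0 | lra].
have /cvgrPdist_lt/(_ _ c0) : (fun j => r ^+ j) @ \oo --> (0 : R).
  by apply: cvg_expr; rewrite ger0_norm /r; lra.
move=> [n _ /(_ n (leqnn n))] /=.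
rewrite sub0r normrN ger0_norm; last by rewrite exprn_ge0// /r; lra.
rewrite ltr_pdivlMr; last by lra.
move=> rn.
pose k := (Num.truncn (s ^+ 2 * n%:R ^+ 2 / (2 * h))).+1.
exists r, n, k; split => //; first by rewrite /r; apply/andP; split; lra.
have k0 : 0 < k%:R :> R by rewrite ltr0n.
have rn0 : 0 <= r ^+ n by rewrite exprn_ge0// /r; lra.
have -> : d = h + h + h by rewrite /h; field.
rewrite r1; apply: lerD; first apply: lerD => //.
  by rewrite mulrA ler_pdivrMr ?exprn_gt0//; apply: le_trans (ltW rn); lra.
have := truncnS_gt (s ^+ 2 * n%:R ^+ 2 / (2 * h)); rewrite -/k.
rewrite ltr_pdivrMr ?mulr_gt0// => /ltW kh.
rewrite ler_pdivrMr ?mulr_gt0//; apply: (le_trans kh).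
by rewrite mulrCA mulrA mulrC mulrA.
Qed.

(** This is [z^n (1 + c L(1/z))] with [L] the truncated logarithm. As [L] has no constant term,
    every term other than [z^n] has lower degree. *)
Definition log_partial_monic {R : realType} (c r : R) (n : nat) : {poly R[i]} :=
  'X^n + \poly_(i < n) ((c * (r ^+ (n - i) / (n - i)%:R))%:C)%C.

Lemma log_partial_monic_monic (R : realType) (c r : R) n :
  log_partial_monic c r n \is monic.
Proof.
rewrite monicE lead_coefDl ?lead_coefXn// size_polyXn ltnS.
exact: size_poly.
Qed.

Lemma horner_log_partial_monic (R : realType) (c r : R) n z : z != 0 ->
  (log_partial_monic c r n).[z] = z ^+ n * (1 + (c%:C)%C * log_partial n r z^-1).
Proof.
move=> z0; rewrite /log_partial_monic hornerD hornerXn horner_poly mulrDr mulr1.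
congr (_ + _); rewrite /log_partial 2!mulr_sumr (reindex_inj rev_ord_inj)/=.
apply: eq_bigr => j _; rewrite subKn ?ltn_ord//.
have zj : z ^+ j.+1 != 0 by rewrite expf_neq0.
have -> : z ^+ n = z ^+ (n - j.+1) * z ^+ j.+1 by rewrite -exprD subnK.
have cM (x y : R) : ((x * y)%:C = x%:C * y%:C)%C by exact: rmorphM.
rewrite cM exprVn.
move: (real_complex R (r ^+ j.+1 / _)) (z ^+ j.+1) zj (z ^+ (n - j.+1)) => b u u0 w.
by field.
Qed.

(** The complex numbers are algebraically closed, so every monic polynomial is a competitor. *)
Lemma monic_cheb_product (R : realType) (p : {poly R[i]}) : p \is monic ->
  exists N (a : 'I_N -> R[i]), p = cheb_product a.
Proof.
move=> /monicP pm; have [rs E] := closed_field_poly_normal p.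
exists (size rs), (tnth (in_tuple rs)).
by rewrite E pm scale1r big_tnth.
Qed.

Lemma exists_product_norm_near1 (R : realType) (s e : R) : 0 <= s -> 0 < e ->
  exists N (a : 'I_N -> R[i]), weighted_norm s (cheb_product a) <= 1 + e.
Proof.
move=> s0 e0.
have d0 : 0 < ln (1 + e) by rewrite ln_gt0//; lra.
have [r [n [k [r01 k0 le_d]]]] := exists_small_parameters s0 d0.
have [N [a aE]] := monic_cheb_product
  (monic_exp k (log_partial_monic_monic (s / k%:R) r n)).
exists N, a; apply: weighted_norm_le => z z1.
have z0 : z != 0 by exact: circle_neq0.
have v1 : normc z^-1 = 1 by rewrite normcV z1 invr1.
rewrite -normc_weight_cheb_product -aE horner_exp horner_log_partial_monic//.
rewrite !(normcM, normc_exp) z1 expr1n mul1r normc_real ger0_norm ?powR_ge0//.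
(* The weight is invariant under [z -> 1/z] on the circle, so the estimates in [v = 1/z] apply. *)
have -> : normc (z - 1) = normc (z^-1 - 1).
  by rewrite -[RHS]mul1r -z1 -normcM mulrBr divff// mulr1 -normc_opp opprB.
apply: (le_trans (weight_approx_le n s0 r01 k0 v1)).
by rewrite -[leRHS]lnK ?posrE ?ler_expR//; lra.
Qed.

(** * Monotonicity over all degrees and the limit *)

Theorem theorem2 (R : realType) (s : R) (hs : 0 <= s) :
  (forall m n : nat, (0 < m)%N -> (m <= n)%N ->
     weighted_norm s (chebyshev_poly s n) <= weighted_norm s (chebyshev_poly s m)) /\
  (fun n : nat => weighted_norm s (chebyshev_poly s n)) @ \oo --> (1 : R).
Proof.
have decr m n : (m <= n)%N ->
    weighted_norm s (chebyshev_poly s n) <= weighted_norm s (chebyshev_poly s m).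
  move=> /subnKC <-; elim: (n - m)%N => [|j IH]; first by rewrite addn0.
  by rewrite addnS; apply: le_trans (chebyshev_norm_decr _ hs) IH.
split=> [m n _|]; first exact: decr.
apply/cvgrPdist_le => e e0.
(* One competitor of norm at most [1 + e], of some degree [N], controls all later degrees by
   monotonicity. *)
have [N [a aN]] := exists_product_norm_near1 hs e0.
exists N => // n /= Nn.
have [b bE] := chebyshev_poly_attained n hs.
have ge1 := one_le_weighted_norm b hs.
have := le_trans (decr _ _ Nn) (le_trans (chebyshev_poly_min a hs) aN).
by rewrite -bE distrC ger0_norm ?subr_ge0//; lra.
Qed.
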